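(* Let $Q$ be a nonempty semisymmetric quasigroup, in the variety $\mathbf{P}$ of semisymmetric quasigroups. Fix $e\in Q$, and let $Q^\#=Q\smallsetminus\{e\}$. Let $\widetilde{G}=U(Q;\mathbf{P})$ be the universal multiplication group of $Q$ in $\mathbf{P}$. Then the universal stabilizer $\widetilde{G}_e$ is free over the set $$\left\{\widetilde{R}(e^2),\ \widetilde{R}(xe)\widetilde{R}(y)\widetilde{R}(xy\cdot e)^{-1},\ \widetilde{R}(xe)\widetilde{R}(ex)\ \middle|\ (x,y)\in Q^\#\times Q,\ y\neq ex\right\}.$$ If $Q$ is finite, of order $n$, then $\widetilde{G}_e\leq\widetilde{G}$ is a free subgroup of rank $n^2-n+1$.
   Context: A quasigroup $(Q,\cdot,/,\backslash)$ is a set with three binary operations satisfying $y\backslash(y\cdot x)=x$, $x=(x\cdot y)/y$, $y\cdot(y\backslash x)=x$, $x=(x/y)\cdot y$. Products are written by concatenation, which binds more tightly than $\cdot$, so $xy\cdot e=(xy)e$, and $e^2=ee$. A quasigroup is semisymmetric if $(yx)y=x$ for all $x,y$; equivalently $y(xy)=x$, equivalently $y\backslash x=xy$, equivalently $y/x=xy$. $\mathbf{P}$ is the variety (category) of semisymmetric quasigroups, with quasigroup homomorphisms. $Q[X]$ is the coproduct in $\mathbf{P}$ of $Q$ with the free semisymmetric quasigroup on the one-element set $\{X\}$; the canonical map $Q\to Q[X]$ is injective and $Q$ is regarded as a subquasigroup of $Q[X]$. For $q\in Q$, $\widetilde{R}(q):u\mapsto uq$ and $\widetilde{L}(q):u\mapsto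 qu$ are the right and left multiplications by $q$ on the set $Q[X]$; they are permutations of $Q[X]$. The universal multiplication group $\widetilde{G}=U(Q;\mathbf{P})$ is the subgroup of the symmetric group on the set $Q[X]$ generated by all $\widetilde{R}(q),\widetilde{L}(q)$, $q\in Q$. Permutations act on the right and are composed left to right. The group $\widetilde{G}$ maps the subset $Q\subseteq Q[X]$ to itself and acts transitively on it; the universal stabilizer $\widetilde{G}_e$ is the stabilizer of the point $e\in Q$ under this action. *)

(* Defs.v *)
From HB Require Import structures.
From mathcomp Require Import all_boot monoid generic_quotient.
From mathcomp Require Import boolp classical_sets functions cardinality.

Set Implicit Arguments.
Unset Strict Implicit.
Unset Printing Implicit Defensive.

Local Open Scope classical_set_scope.
Local Open Scope group_scope.

Declare Scope quasigroup_scope.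
Delimit Scope quasigroup_scope with Q.

HB.mixin Record isQuasigroup Q := {
  qmul : Q -> Q -> Q;
  qrdiv : Q -> Q -> Q; (* qrdiv x y is x / y *)
  qldiv : Q -> Q -> Q; (* qldiv y x is y \ x *)
  qmulKl : forall y x, qldiv y (qmul y x) = x;
  qmulKr : forall x y, qrdiv (qmul x y) y = x;
  qldivK : forall y x, qmul y (qldiv y x) = x;
  qrdivK : forall x y, qmul (qrdiv x y) y = x
}.

#[short(type="quasigroupType")]
HB.structure Definition Quasigroup := {Q of isQuasigroup Q}.

Infix "**" := qmul (at level 40, left associativity) : quasigroup_scope.
Local Open Scope quasigroup_scope.
Local Open Scope quotient_scope.

HB.mixin Record isSemisymmetric Q of Quasigroup Q := {
  qmulKK : forall x y : Q, (y ** x) ** y = x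
}.

#[short(type="semisymmetricType")]
HB.structure Definition Semisymmetric := {Q of isSemisymmetric Q & Quasigroup Q}.

Definition quasigroup_hom (A B : quasigroupType) (f : A -> B) : Prop :=
  [/\ forall x y, f (x ** y) = f x ** f y,
      forall x y, f (qrdiv x y) = qrdiv (f x) (f y) &
      forall x y, f (qldiv x y) = qldiv (f x) (f y)].

Definition is_free_on (T : Type) (F : semisymmetricType) (g : T -> F) : Prop :=
  forall (M : semisymmetricType) (f : T -> M),
    exists h : F -> M,
      [/\ quasigroup_hom h,
          forall t, h (g t) = f t &
          forall h' : F -> M, quasigroup_hom h' ->
            (forall t, h' (g t) = f t) -> h' =1 h].

Definition is_coproduct (A B C : semisymmetricType)
    (iA : A -> C) (iB : B -> C) : Prop :=
  [/\ quasigroup_hom iA, quasigroup_hom iB &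
  forall (M : semisymmetricType) (f : A -> M) (g : B -> M),
    quasigroup_hom f -> quasigroup_hom g ->
    exists h : C -> M,
      [/\ quasigroup_hom h,
          forall a, h (iA a) = f a,
          forall b, h (iB b) = g b &
          forall h' : C -> M, quasigroup_hom h' ->
            (forall a, h' (iA a) = f a) -> (forall b, h' (iB b) = g b) ->
            h' =1 h]].

(* [i : Q -> QX] exhibits QX as Q[X], defined up to isomorphism; the
   indeterminate itself is the image of the free generator *)
Definition is_adjoin_free (Q QX : semisymmetricType) (i : Q -> QX) : Prop :=
  exists (F : semisymmetricType) (X : F) (j : F -> QX),
    is_free_on (fun _ : unit => X) /\ is_coproduct i j.

Record symg (T : Type) := Symg {
  symg_fun :> T -> T;
  symg_inv : T -> T;
  symgK : cancel symg_fun symg_inv;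
  symgVK : cancel symg_inv symg_fun
}.

HB.instance Definition _ (T : Type) := gen_eqMixin (symg T).
HB.instance Definition _ (T : Type) := gen_choiceMixin (symg T).

Section SymmetricGroup.
Variable T : Type.
Implicit Types s t : symg T.

Lemma symgP s t : (s : T -> T) =1 t -> s = t.
Proof.
case: s t => [f f' fK f'K] [g g' gK g'K] /= /funext fg; subst g.
have ff' : f' = g' by apply/funext => u; rewrite -[u in LHS]g'K fK.
by subst g'; congr Symg; exact: Prop_irrelevance.
Qed.

Definition symg1 : symg T := @Symg T id id (frefl _) (frefl _).
Definition symgV s : symg T := Symg (symgVK s) (symgK s).

(* permutations act on the right: s * t is s followed by t *)
Definition symgM s t : symg T :=
  @Symg T (fun u => t (s u)) (fun u => symg_inv s (symg_inv t u))
    (can_comp (symgK t) (symgK s)) (can_comp (symgVK s) (symgVK t)).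

Lemma symgMA : associative symgM. Proof. by move=> *; exact: symgP. Qed.
Lemma symg1M : left_id symg1 symgM. Proof. by move=> *; exact: symgP. Qed.
Lemma symgM1 : right_id symg1 symgM. Proof. by move=> *; exact: symgP. Qed.
Lemma symgVM : left_inverse symg1 symgV symgM.
Proof. by move=> s; apply: symgP => u /=; rewrite symgVK. Qed.
Lemma symgMV : right_inverse symg1 symgV symgM.
Proof. by move=> s; apply: symgP => u /=; rewrite symgK. Qed.

HB.instance Definition _ :=
  isGroup.Build (symg T) symgMA symg1M symgM1 symgVM symgMV.

End SymmetricGroup.

Definition is_subgroup (G : groupType) (H : set G) : Prop :=
  H 1 /\ forall a b, H a -> H b -> H (a / b).

Definition generated (G : groupType) (S : set G) : set G :=
  smallest (@is_subgroup G) S.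

Definition hom_on (G K : groupType) (H : set G) (h : G -> K) : Prop :=
  forall a b, H a -> H b -> h (a * b) = h a * h b.

(* Maps out of S and out of H are represented by total maps on G, only the
   values on S, respectively on H, being relevant *)
Definition free_over (G : groupType) (H S : set G) : Prop :=
  [/\ is_subgroup H, S `<=` H &
  forall (K : groupType) (f : G -> K),
    exists h : G -> K,
      [/\ hom_on H h,
          forall s, S s -> h s = f s &
          forall h' : G -> K, hom_on H h' -> (forall s, S s -> h' s = f s) ->
            forall a, H a -> h' a = h a]].

Definition free_of_rank (G : groupType) (H : set G) (n : nat) : Prop :=
  exists S : set G, free_over H S /\ (S #= `I_n)%card.

Definition qRmul (M : quasigroupType) (q : M) : symg M :=
  @Symg M (fun u => u ** q) (fun u => qrdiv u q)
    (fun u => qmulKr u q) (fun u => qrdivK u q).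

Definition qLmul (M : quasigroupType) (q : M) : symg M :=
  @Symg M (fun u => q ** u) (fun u => qldiv q u)
    (fun u => qmulKl q u) (fun u => qldivK q u).

Section UniversalMultiplicationGroup.
Variables (Q QX : semisymmetricType) (i : Q -> QX).

Definition Rtilde (q : Q) : symg QX := qRmul (i q).
Definition Ltilde (q : Q) : symg QX := qLmul (i q).

Definition univ_mult_group : set (symg QX) :=
  generated (range Rtilde `|` range Ltilde).

Definition univ_stabilizer (e : Q) : set (symg QX) :=
  [set g | univ_mult_group g /\ g (i e) = i e].

Definition stabilizer_basis (e : Q) : set (symg QX) :=
  [set Rtilde (e ** e)]
  `|` [set g | exists x y, [/\ x <> e, y <> e ** x &
         g = Rtilde (x ** e) * Rtilde y * (Rtilde (x ** y ** e))^-1]]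
  `|` [set g | exists2 x, x <> e & g = Rtilde (x ** e) * Rtilde (e ** x)].

End UniversalMultiplicationGroup.

Section Presentation.

Inductive qterm (T : Type) :=
| QGen of T
| QMul of qterm T & qterm T
| QRdiv of qterm T & qterm T
| QLdiv of qterm T & qterm T.

Fixpoint qeval T (M : quasigroupType) (f : T -> M) (t : qterm T) : M :=
  match t with
  | QGen x => f x
  | QMul s t => qeval f s ** qeval f t
  | QRdiv s t => qrdiv (qeval f s) (qeval f t)
  | QLdiv s t => qldiv (qeval f s) (qeval f t)
  end.

Variables (T : Type) (r : qterm T -> qterm T -> Prop).

Inductive qequiv : qterm T -> qterm T -> Prop :=
| qe_base s t of r s t : qequiv s t
| qe_refl t : qequiv t t
| qe_sym s t of qequiv s t : qequiv t s
| qe_trans s t u of qequiv s t & qequiv t u : qequiv s u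
| qe_mul s s' t t' of qequiv s s' & qequiv t t' :
    qequiv (QMul s t) (QMul s' t')
| qe_rdiv s s' t t' of qequiv s s' & qequiv t t' :
    qequiv (QRdiv s t) (QRdiv s' t')
| qe_ldiv s s' t t' of qequiv s s' & qequiv t t' :
    qequiv (QLdiv s t) (QLdiv s' t')
| qe_mulKl y x : qequiv (QLdiv y (QMul y x)) x
| qe_mulKr x y : qequiv (QRdiv (QMul x y) y) x
| qe_ldivK y x : qequiv (QMul y (QLdiv y x)) x
| qe_rdivK x y : qequiv (QMul (QRdiv x y) y) x
| qe_mulKK x y : qequiv (QMul (QMul y x) y) x.

HB.instance Definition _ := gen_eqMixin (qterm T).
HB.instance Definition _ := gen_choiceMixin (qterm T).

Definition qequivb (s t : qterm T) : bool := `[< qequiv s t >].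

Lemma qequivb_refl : reflexive qequivb.
Proof. by move=> t; apply/asboolP; exact: qe_refl. Qed.
Lemma qequivb_sym : symmetric qequivb.
Proof. by move=> s t; apply/idP/idP => /asboolP/qe_sym/asboolP. Qed.
Lemma qequivb_trans : transitive qequivb.
Proof.
move=> t s u /asboolP st /asboolP tu; apply/asboolP; exact: qe_trans st tu.
Qed.

Canonical qequivb_equiv := EquivRel qequivb qequivb_refl qequivb_sym qequivb_trans.

Definition presented := {eq_quot qequivb_equiv}.
Let class (t : qterm T) : presented := \pi_presented t.

Let classP s t : (class s = class t) <-> qequiv s t.
Proof. by split=> [/eqmodP/asboolP //|st]; apply/eqmodP/asboolP. Qed.

Let reprP (a : presented) : class (repr a) = a. Proof. exact: reprK. Qed.
Let reprE t : qequiv (repr (class t)) t. Proof. by apply/classP/reprP. Qed.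

Definition pmul (a b : presented) := class (QMul (repr a) (repr b)).
Definition prdiv (a b : presented) := class (QRdiv (repr a) (repr b)).
Definition pldiv (a b : presented) := class (QLdiv (repr a) (repr b)).

Let pmulE s t : pmul (class s) (class t) = class (QMul s t).
Proof. by apply/classP; apply: qe_mul. Qed.
Let prdivE s t : prdiv (class s) (class t) = class (QRdiv s t).
Proof. by apply/classP; apply: qe_rdiv. Qed.
Let pldivE s t : pldiv (class s) (class t) = class (QLdiv s t).
Proof. by apply/classP; apply: qe_ldiv. Qed.

Let pmulKl y x : pldiv y (pmul y x) = x.
Proof.
rewrite -(reprP y) -(reprP x) pmulE pldivE; apply/classP; exact: qe_mulKl.
Qed.
Let pmulKr x y : prdiv (pmul x y) y = x.
Proof.
rewrite -(reprP y) -(reprP x) pmulE prdivE; apply/classP; exact: qe_mulKr.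
Qed.
Let pldivK y x : pmul y (pldiv y x) = x.
Proof.
rewrite -(reprP y) -(reprP x) pldivE pmulE; apply/classP; exact: qe_ldivK.
Qed.
Let prdivK x y : pmul (prdiv x y) y = x.
Proof.
rewrite -(reprP y) -(reprP x) prdivE pmulE; apply/classP; exact: qe_rdivK.
Qed.
Let pmulKK x y : pmul (pmul y x) y = x.
Proof.
rewrite -(reprP y) -(reprP x) !pmulE; apply/classP; exact: qe_mulKK.
Qed.

HB.instance Definition _ :=
  isQuasigroup.Build presented pmulKl pmulKr pldivK prdivK.
HB.instance Definition _ := isSemisymmetric.Build presented pmulKK.

Lemma presentation : exists (P : semisymmetricType) (g : T -> P),
  (forall s t, r s t -> qeval g s = qeval g t) /\
  forall (M : semisymmetricType) (f : T -> M),
    (forall s t, r s t -> qeval f s = qeval f t) ->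
    exists h : P -> M,
      [/\ quasigroup_hom h,
          forall t, h (g t) = f t &
          forall h' : P -> M, quasigroup_hom h' ->
            (forall t, h' (g t) = f t) -> h' =1 h].
Proof.
exists presented, (fun t => class (QGen t)).
have evalE s : qeval (fun t => class (QGen t) : presented) s = class s.
  elim: s => //= s -> t ->; [exact: pmulE|exact: prdivE|exact: pldivE].
split=> [s t rst|M f fr]; first by rewrite !evalE; apply/classP/qe_base.
have fE s t : qequiv s t -> qeval f s = qeval f t.
  elim=> {s t} /=; do ?by move=> *; congruence.
  - by move=> s t /fr.
  - by move=> *; rewrite qmulKl.
  - by move=> *; rewrite qmulKr.
  - by move=> *; rewrite qldivK.
  - by move=> *; rewrite qrdivK.
  - by move=> *; rewrite qmulKK.
exists (fun a => qeval f (repr a)); split.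
- by split=> a b; apply: (fE _ _ (reprE _)).
- by move=> t; apply: (fE _ _ (reprE _)).
- move=> h' [hM hR hL] hg a; rewrite -{1}(reprP a) -evalE.
  by elim: (repr a) => //= s IHs t IHt; rewrite (hM, hR, hL) IHs IHt.
Qed.

End Presentation.

Lemma free_on_exists (T : Type) :
  exists (F : semisymmetricType) (g : T -> F), is_free_on g.
Proof.
have [P [g [_ Pg]]] := @presentation T (fun _ _ => False).
by exists P, g => M f; apply: Pg.
Qed.

Inductive coproduct_rel (A B : quasigroupType) :
    qterm (A + B) -> qterm (A + B) -> Prop :=
| cr_mull a b : coproduct_rel
    (QMul (QGen (inl a)) (QGen (inl b))) (QGen (inl (a ** b)))
| cr_rdivl a b : coproduct_rel
    (QRdiv (QGen (inl a)) (QGen (inl b))) (QGen (inl (qrdiv a b)))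
| cr_ldivl a b : coproduct_rel
    (QLdiv (QGen (inl a)) (QGen (inl b))) (QGen (inl (qldiv a b)))
| cr_mulr a b : coproduct_rel
    (QMul (QGen (inr a)) (QGen (inr b))) (QGen (inr (a ** b)))
| cr_rdivr a b : coproduct_rel
    (QRdiv (QGen (inr a)) (QGen (inr b))) (QGen (inr (qrdiv a b)))
| cr_ldivr a b : coproduct_rel
    (QLdiv (QGen (inr a)) (QGen (inr b))) (QGen (inr (qldiv a b))).

Lemma coproduct_exists (A B : semisymmetricType) :
  exists (C : semisymmetricType) (iA : A -> C) (iB : B -> C),
    is_coproduct iA iB.
Proof.
have [P [g [gr Pg]]] := presentation (@coproduct_rel A B).
exists P, (fun a => g (inl a)), (fun b => g (inr b)); split.
- split=> a b; apply/esym.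
  + exact: gr (cr_mull B a b).
  + exact: gr (cr_rdivl B a b).
  + exact: gr (cr_ldivl B a b).
- split=> a b; apply/esym.
  + exact: gr (cr_mulr A a b).
  + exact: gr (cr_rdivr A a b).
  + exact: gr (cr_ldivr A a b).
move=> M f k [fM fR fL] [kM kR kL].
have [|h [hh hg hU]] :=
    Pg M (fun c => match c with inl a => f a | inr b => k b end).
  by move=> s t [] a b /=.
exists h; split=> // [a|b|h' hh' hf hk].
- by rewrite hg.
- by rewrite hg.
- by apply: hU => // -[].
Qed.

Lemma adjoin_free_exists (Q : semisymmetricType) :
  exists (QX : semisymmetricType) (i : Q -> QX), is_adjoin_free i.
Proof.
have [F [g Fg]] := free_on_exists unit.
have [QX [i [j ij]]] := coproduct_exists Q F.
exists QX, i, F, (g tt), j; split=> //.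
by rewrite (_ : (fun=> _) = g)//; apply/funext => -[].
Qed.

(* Main.v *)
Require Import Defs.
From HB Require Import structures.
From mathcomp Require Import all_boot monoid.
From mathcomp Require Import boolp classical_sets functions cardinality.

(* Since q(xq) = x, left multiplications are inverse to right multiplications,
   and R(xe) maps e to x.  So the R(xe), with 1 instead of R(e^2) for x = e,
   form a Schreier transversal of the stabilizer of e, and the listed elements
   are its nontrivial Schreier generators t_x R(y) t_(xy)^-1; this gives
   generation.  For freeness, let c : Q -> Q -> K be any assignment of values in
   a group K to the pairs (x, y), trivial on the edges (e, y), y <> e^2, of the
   Schreier tree.  The skew product of Q by c turns two copies of Q * K into a
   semisymmetric quasigroup, in which Q is the subquasigroup of the (q, 1) in
   the first copy, and acts on the second copy by
   (x, k) q = (xq, k c(x, q)).  Sending X to (e, 1) in the second copy and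
   following the K-coordinate of the image of X yields a homomorphism from the
   stabilizer to K with prescribed values c(x, y) on the generators. *)

Set Implicit Arguments.
Unset Strict Implicit.
Unset Printing Implicit Defensive.

Local Open Scope classical_set_scope.
Local Open Scope card_scope.
Local Open Scope group_scope.
Local Open Scope quasigroup_scope.

(** * Divisions and left multiplications in terms of products *)

Section SemisymmetricTheory.
Variable Q : semisymmetricType.
Implicit Types x y : Q.

Lemma qmulKK' x y : y ** (x ** y) = x.
Proof. by rewrite -{1}(qmulKK y x) (qmulKK x). Qed.

Lemma qldivE x y : qldiv x y = y ** x.
Proof. by rewrite -[y in LHS](qmulKK' y x) qmulKl. Qed.

Lemma qrdivE x y : qrdiv x y = y ** x.
Proof. by rewrite -[x in LHS](qmulKK x y) qmulKr. Qed.

Lemma qLmulE x : qLmul x = (qRmul x)^-1.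
Proof. by apply: symgP => u /=; rewrite qrdivE. Qed.

End SemisymmetricTheory.

Lemma mul_quasigroup_hom (A B : semisymmetricType) (f : A -> B) :
  (forall x y, f (x ** y) = f x ** f y) -> quasigroup_hom f.
Proof. by move=> fM; split=> // x y; rewrite ?(qrdivE, qldivE) fM. Qed.

HB.factory Record Mul_isSemisymmetric M := {
  op : M -> M -> M;
  opKK : forall x y, op (op y x) y = x
}.

HB.builders Context M of Mul_isSemisymmetric M.

Fact opKK' x y : op y (op x y) = x.
Proof. by rewrite -{1}(opKK y x) (opKK x). Qed.

HB.instance Definition _ :=
  @isQuasigroup.Build M op (fun x y => op y x) (fun x y => op y x)
    (fun y x => opKK x y) (fun x y => opKK' x y)
    (fun y x => opKK' x y) (fun x y => opKK x y).
HB.instance Definition _ := isSemisymmetric.Build M opKK.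

HB.end.

(** * Skew product of [Q] with a group *)

Section SkewProduct.
Variables (Q : semisymmetricType) (K : groupType) (c : Q -> Q -> K).

(* The cocycle is a phantom argument: the multiplication depends on it. *)
Definition skew of Q -> Q -> K : Type := (bool * Q * K)%type.

(* The products (true, x, k) (false, y, r) are chosen, and the next two cases
   are then forced by semisymmetry.  In the first case, (k, r) |-> k^-1 r^-1 is
   a semisymmetric multiplication on any group, with 1 idempotent. *)
Definition skew_mul (u v : skew c) : skew c :=
  let: (a, x, k) := u in let: (b, y, r) := v in
  (a (+) b, x ** y,
    match a, b with
    | false, false => k^-1 * r^-1
    | true, false => k * r * c x y
    | false, true => r * (c (x ** y) x)^-1 * k^-1
    | true, true => r^-1 * k * (c y (x ** y))^-1
    end).

Fact skew_mulKK u v : skew_mul (skew_mul v u) v = u.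
Proof.
case: u v => [[[] x] k] [[[] y] r] /=; rewrite ?qmulKK ?qmulKK';
  by congr (_, _, _); rewrite ?invgM ?invgK ?mulgA
    ?(mulgK, mulgVK, mulVg, mul1g, mulgV, mulKg).
Qed.

HB.instance Definition _ := @Mul_isSemisymmetric.Build (skew c) _ skew_mulKK.

Definition skew_in (q : Q) : skew c := (false, q, 1).

Lemma skew_in_hom : quasigroup_hom skew_in.
Proof.
by apply: mul_quasigroup_hom => x y; congr (_, _, _); rewrite invg1 mulg1.
Qed.

Lemma skew_mul_in x k q :
  ((true, x, k) : skew c) ** skew_in q = (true, x ** q, k * c x q).
Proof. by congr (_, _, _); rewrite mulg1. Qed.

Lemma skew_in_mul x k q :
  skew_in q ** ((true, x, k) : skew c) = (true, q ** x, k * (c (q ** x) q)^-1).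
Proof. by congr (_, _, _); rewrite invg1 mulg1. Qed.

End SkewProduct.

(** * Generated subgroups and homomorphisms on subgroups *)

Section Generated.
Variable G : groupType.
Implicit Types (S H : set G) (a b : G).

Lemma generated_subgroup S : is_subgroup (generated S).
Proof.
split=> [H [[H1 _] _] //|a b Sa Sb H HS].
by case: (HS) => -[_ HB] _; apply: HB; [apply: Sa|apply: Sb].
Qed.

Lemma sub_generated S : S `<=` generated S.
Proof. by move=> a Sa H [_]; apply. Qed.

Lemma generated_ind S H : is_subgroup H -> S `<=` H -> generated S `<=` H.
Proof. by move=> Hg SH a; apply. Qed.

Lemma subgroupV H a : is_subgroup H -> H a -> H a^-1.
Proof. by move=> [H1 HB] Ha; rewrite -div1g; apply: HB. Qed.

Lemma subgroupM H a b : is_subgroup H -> H a -> H b -> H (a * b).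
Proof.
by move=> Hg Ha Hb; rewrite -[b]invgK; apply: Hg.2 => //; apply: subgroupV.
Qed.

Lemma hom_on_div (K : groupType) H (h : G -> K) a b :
  is_subgroup H -> hom_on H h -> H a -> H b -> h (a / b) = h a / h b.
Proof.
move=> Hg hM Ha Hb; apply: (mulIg (h b)); rewrite -hM ?mulgVK //.
exact: Hg.2.
Qed.

Lemma hom_on1 (K : groupType) H (h : G -> K) :
  is_subgroup H -> hom_on H h -> h 1 = 1.
Proof.
by move=> Hg hM; rewrite -(mulgV 1) (hom_on_div Hg) ?mulgV //; case: Hg.
Qed.

End Generated.

(** * Universal property of [QX] and the action of [U] *)

Section UniversalStabilizer.
Variables (Q QX : semisymmetricType) (i : Q -> QX).
Hypothesis hQX : is_adjoin_free i.

Local Notation R := (Rtilde i).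
Local Notation U := (univ_mult_group i).

Lemma adjoin_free_hom : quasigroup_hom i.
Proof. by case: hQX => F [X [j [_ []]]]. Qed.

Lemma adjoin_freeM x y : i (x ** y) = i x ** i y.
Proof. by case: adjoin_free_hom. Qed.

Lemma adjoin_free_indeterminate : exists X0 : QX,
  forall (M : semisymmetricType) (f : Q -> M) (m : M), quasigroup_hom f ->
  exists h : QX -> M,
    [/\ forall u v, h (u ** v) = h u ** h v, forall q, h (i q) = f q & h X0 = m].
Proof.
case: hQX => F [X [j [freeF [_ _ coprod]]]]; exists (j X) => M f m fhom.
have [g [ghom gX _]] := freeF M (fun=> m).
have [h [[hM _ _] hi hj _]] := coprod M f g fhom ghom.
by exists h; split=> //; rewrite hj (gX tt).
Qed.

Lemma adjoin_free_retraction (e : Q) : exists p : QX -> Q,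
  (forall u v, p (u ** v) = p u ** p v) /\ cancel i p.
Proof.
have [X0 univ] := adjoin_free_indeterminate.
have [|p [pM pi _]] := univ Q id e; first exact: mul_quasigroup_hom.
by exists p.
Qed.

Lemma univ_subgroup : is_subgroup U.
Proof. exact: generated_subgroup. Qed.

Lemma univ_Rtilde q : U (R q).
Proof. by apply: sub_generated; left; exists q. Qed.

Lemma univ_mult_group_ind (H : set (symg QX)) :
  is_subgroup H -> (forall q, H (R q)) -> U `<=` H.
Proof.
move=> Hg HR; apply: generated_ind => // _ [] [q _ <-]; first exact: HR.
by rewrite /Ltilde qLmulE; apply: subgroupV => //; apply: HR.
Qed.

(** The retraction commutes with each [R q], hence with all of [U]. With [u = i x] this shows that
    [U] maps the image of [i] to itself. *)
Lemma univ_retraction (p : QX -> Q) (g : symg QX) :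
  (forall u v, p (u ** v) = p u ** p v) -> cancel i p ->
  U g -> forall u, i (p (g u)) = g (i (p u)).
Proof.
move=> pM pi; move: g; apply: univ_mult_group_ind.
  split=> // a b Ha Hb u; apply: (can_inj (symgK b)).
  by rewrite -Hb /= !symgVK Ha.
by move=> q u /=; rewrite pM pi adjoin_freeM.
Qed.

Section Point.
Variable e : Q.

Local Notation H := (univ_stabilizer i e).

Lemma univ_stabilizer_subgroup : is_subgroup H.
Proof.
split=> [|a b [Ua ae] [Ub be]]; first by split=> //; case: univ_subgroup.
split; first exact: univ_subgroup.2.
by apply: (can_inj (symgK b)); rewrite /= symgVK ae be.
Qed.

(** * Schreier transversal and Schreier generators *)

Definition transversal (x : Q) : symg QX :=
  if `[< x = e >] then 1 else R (x ** e).

Definition schreier (p : Q * Q) : symg QX :=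
  transversal p.1 * R p.2 * (transversal (p.1 ** p.2))^-1.

(** A pair [(x, y)] is the edge from [x] to [x ** y]. The spanning tree is the star of all edges
    leaving [e], except the loop [(e, e ** e)]. *)
Definition nontree : set (Q * Q) := [set p | p.1 <> e \/ p.2 = e ** e].

Lemma transversal_e : transversal e = 1.
Proof. by rewrite /transversal asboolT. Qed.

Lemma transversal_neq x : x <> e -> transversal x = R (x ** e).
Proof. by move=> xe; rewrite /transversal asboolF. Qed.

Lemma univ_transversal x : U (transversal x).
Proof.
rewrite /transversal; case: asboolP => _; last exact: univ_Rtilde.
by case: univ_subgroup.
Qed.

Lemma transversalE x : transversal x (i e) = i x.
Proof.
rewrite /transversal; case: asboolP => [->//|_] /=.
by rewrite -adjoin_freeM qmulKK'.
Qed.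

Lemma schreier_stabilizer p : H (schreier p).
Proof.
rewrite /schreier; split.
  apply: univ_subgroup.2; last exact: univ_transversal.
  apply: (subgroupM univ_subgroup); last exact: univ_Rtilde.
  exact: univ_transversal.
apply: (can_inj (symgK (transversal (p.1 ** p.2)))).
by rewrite /= symgVK !transversalE /= adjoin_freeM.
Qed.

Lemma schreier_tree p : ~ nontree p -> schreier p = 1.
Proof.
case: p => x y /not_orP[/= /contrapT -> yee].
rewrite /schreier /= transversal_e mul1g transversal_neq ?qmulKK ?mulgV//.
by move=> eye; apply: yee; rewrite -[LHS](qmulKK y e) eye.
Qed.

(** The three families come from the loop at [e], from the edges between points other than [e], and
    from the edges back to [e], which are the [(x, e ** x)]. *)
Lemma stabilizer_basisE : stabilizer_basis i e = schreier @` nontree.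
Proof.
have schreier_e : schreier (e, e ** e) = R (e ** e).
  by rewrite /schreier /= qmulKK' transversal_e mul1g invg1 mulg1.
have schreier_ret x : x <> e -> schreier (x, e ** x) = R (x ** e) * R (e ** x).
  move=> xe; rewrite /schreier/= qmulKK' transversal_e invg1 mulg1.
  by rewrite transversal_neq.
have schreier_gen x y : x <> e -> y <> e ** x ->
    schreier (x, y) = R (x ** e) * R y * (R (x ** y ** e))^-1.
  move=> xe yex; rewrite /schreier/= !transversal_neq// => xye.
  by apply: yex; rewrite -xye qmulKK.
apply/seteqP; split=> [g [[->|[x [y [xe yex ->]]]]|[x xe ->]]|].
- by exists (e, e ** e) => //; right.
- by exists (x, y); [left|apply: schreier_gen].
- by exists (x, e ** x); [left|apply: schreier_ret].
move=> _ [[x y] /= xyD <-]; have [xe|xe] := pselect (x = e).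
  by case: xyD => [//|/= ->]; left; left; rewrite xe.
have [->|yex] := pselect (y = e ** x).
  by right; exists x => //; rewrite schreier_ret.
by left; right; exists x, y; split=> //; apply: schreier_gen.
Qed.

Lemma generated_schreier : H `<=` generated (schreier @` nontree).
Proof.
set N := generated _; have Ng : is_subgroup N by exact: generated_subgroup.
have [p [pM pi]] := adjoin_free_retraction e.
(* Schreier's argument: the claim is extended to all of [U], where it passes to quotients because
   the transversal factors at the intermediate point cancel. *)
suff main : U `<=` [set g | U g /\ forall x y, g (i x) = i y ->
    N (transversal x * g * (transversal y)^-1)].
  move=> g [/main[_ /(_ e e) +] ge] => /(_ ge).
  by rewrite transversal_e mul1g invg1 mulg1.
apply: univ_mult_group_ind; last first.
  move=> q; split; first exact: univ_Rtilde.
  move=> x y /=; rewrite -adjoin_freeM => /(can_inj pi) <-.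
  have [xqD|xqD] := pselect (nontree (x, q)).
    by apply: sub_generated; exists (x, q).
  by rewrite -[X in N X]/(schreier (x, q)) schreier_tree//; case: Ng.
split=> [|a b [Ua Na] [Ub Nb]].
  split=> [|x y /(can_inj pi) ->]; first by case: univ_subgroup.
  by rewrite mulg1 mulgV; case: Ng.
split=> [|x z /= abx]; first exact: univ_subgroup.2.
have ax := univ_retraction pM pi Ua (i x); rewrite pi in ax.
have bz : b (i z) = i (p (a (i x))) by rewrite -abx symgVK ax.
have /= := Ng.2 _ _ (Na _ _ (esym ax)) (Nb _ _ bz).
by rewrite !invgM !invgK !mulgA mulgVK.
Qed.

(** * Homomorphisms with prescribed values on the Schreier generators *)

Section Homomorphism.
Variables (K : groupType) (c : Q -> Q -> K).
Hypothesis c_tree : forall x y, ~ nontree (x, y) -> c x y = 1.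

Lemma schreier_hom : exists h : symg QX -> K,
  hom_on H h /\ forall p, h (schreier p) = c p.1 p.2.
Proof.
have [X0 univ] := adjoin_free_indeterminate.
have [f [fM fi fX]] := univ (skew c) _ (true, e, 1) (@skew_in_hom _ _ c).
(* [U] changes [K]-coordinates in the second copy by right factors depending only on the point of
   [Q], so it preserves left translation by [k]. *)
pose shifted k u v := exists x r, f u = (true, x, r) /\ f v = (true, x, k * r).
have shiftedE g : U g -> forall k u v, shifted k (g u) (g v) <-> shifted k u v.
  move: g; apply: univ_mult_group_ind; first split=> // a b Ha Hb k u v.
    by rewrite -Hb /= !symgVK Ha.
  move=> q k u v; split=> -[x [r [fu fv]]]; last first.
    exists (x ** q), (r * c x q); rewrite /= !fM fu fv fi !skew_mul_in.
    by rewrite mulgA.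
  exists (q ** x), (r * (c (q ** x) q)^-1).
  rewrite -[u](qmulKK' _ (i q)) -[v](qmulKK' _ (i q)) 2!(fM (i q)).
  by rewrite -[u ** _]/(R q u) -[v ** _]/(R q v) fu fv fi
     !skew_in_mul mulgA.
have f1M u v : (f (u ** v)).1.2 = (f u).1.2 ** (f v).1.2.
  by rewrite fM; case: (f u) (f v) => [[a x] k] [[b y] r].
have f1i : cancel i (fun u => (f u).1.2) by move=> q; rewrite fi.
have ftag g : U g -> forall u, (f (g u)).1.1 = (f u).1.1.
  move: g; apply: univ_mult_group_ind.
    by split=> // a b Ha Hb u /=; rewrite -Hb symgVK Ha.
  by move=> q u /=; rewrite fM fi; case: (f u) => [[[] x] k].
have fH g : H g -> f (g X0) = (true, e, (f (g X0)).2).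
  move=> [Ug ge]; have := ftag _ Ug X0.
  have := univ_retraction f1M f1i Ug X0; rewrite fX ge => /(can_inj f1i).
  by case: (f (g X0)) => [[a x] k] /= -> ->.
exists (fun g => (f (g X0)).2); split=> [a b Ha Hb|[x y] /=].
  (* Applying [b] to this translation multiplies the coordinate of [b X0] on the left by that of
     [a X0]. *)
  have : shifted (f (a X0)).2 X0 (a X0).
    by exists e, 1; rewrite fX mulg1 -fH.
  move=> /(shiftedE _ Hb.1) [x [r []]].
  by rewrite (fH _ Hb) /= => -[_ <-] ->.
(* For [z <> e] the path to [z] is the tree edge [(e, z ** e)], where [c] is trivial. *)
have fT z : f (transversal z X0) = (true, z, 1).
  rewrite /transversal; case: asboolP => [->//|ze] /=.
  rewrite fM fX fi skew_mul_in qmulKK' c_tree ?mulg1//.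
  by case=> //= zee; apply: ze; rewrite -[LHS](qmulKK' z e) zee qmulKK'.
set w := (symg_inv _ _).
have : shifted (c x y) X0 w.
  apply/(shiftedE _ (univ_transversal (x ** y))).
  exists (x ** y), 1; rewrite fT mulg1 /w symgVK; split=> //.
  by rewrite fM fT fi skew_mul_in mul1g.
by move=> [z [r [+ ->]]]; rewrite fX => -[_ <-] /=; rewrite mulg1.
Qed.

End Homomorphism.

Lemma schreier_inj : {in nontree &, injective schreier}.
Proof.
move=> p p' /set_mem pD _ eqs; apply: contrapT => pp'.
pose flip : symg bool := Symg negbK negbK.
(* As [p] is not in the tree, this [c] is admissible; the resulting homomorphism separates
   [schreier p] from every other generator. *)
pose c x y : symg bool := if `[< (x, y) = p >] then flip else 1.
have [|h [_ hE]] := @schreier_hom _ c.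
  by move=> x y xyD; rewrite /c asboolF// => xyp; rewrite xyp in xyD.
have := hE p; rewrite eqs hE /c -!surjective_pairing asboolF ?asboolT//.
  by move=> /(congr1 (fun g : symg bool => g true)).
by move=> p'p; apply: pp'.
Qed.

Lemma univ_stabilizer_free : free_over H (stabilizer_basis i e).
Proof.
have Hg := univ_stabilizer_subgroup.
rewrite stabilizer_basisE; split=> // [_ [p _ <-]|K f].
  exact: schreier_stabilizer.
pose c x y := if `[< nontree (x, y) >] then f (schreier (x, y)) else 1.
have [|h [hM hE]] := @schreier_hom _ c.
  by move=> x y xyD; rewrite /c asboolF.
have hf s : (schreier @` nontree) s -> h s = f s.
  by case=> -[x y] pD <-; rewrite hE /c asboolT.
exists h; split=> // h' h'M h'f a Ha.
suff: generated (schreier @` nontree) `<=` [set g | H g /\ h' g = h g].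
  by move=> /(_ _ (generated_schreier Ha))[].
apply: generated_ind => [|s Ss]; last first.
  by split; [case: Ss => p _ <-; apply: schreier_stabilizer|rewrite hf// h'f].
split=> [|b b' [Hb hb] [Hb' hb']].
  by split; [case: Hg|rewrite !(hom_on1 Hg)].
by split; [apply: Hg.2|rewrite !(hom_on_div Hg)// hb hb'].
Qed.

End Point.
End UniversalStabilizer.

(** * Counting the edges outside the tree *)

Lemma card_eq_fin (T : finType) (A : {pred T}) : [set x | x \in A] #= `I_#|A|.
Proof.
rewrite (card_eqr card_II).
have <- : enum_val @` [set: 'I_#|A|] = [set x | x \in A].
  apply/seteqP; split=> [_ [j _ <-]|x xA]; first exact: enum_valP.
  by exists (enum_rank_in xA x) => //; rewrite enum_rankK_in.
by apply: inj_card_eq => ? ? _ _; apply: enum_val_inj.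
Qed.

Lemma card_nontree (Q : semisymmetricType) (e : Q) (n : nat) :
  [set: Q] #= `I_n -> nontree e #= `I_(n ^ 2 - n + 1)%N.
Proof.
case: n => [|m] /card_set_bijP[f [fT finj fsurj]]; first by have := fT e I.
pose v x : 'I_m.+1 := inord (f x).
have fv x : v x = f x :> nat by rewrite inordK //; apply: fT.
have vinj : injective v.
  by move=> x y /(congr1 val); rewrite /= !fv; apply: finj; rewrite inE.
have vsurj (j : 'I_m.+1) : exists x, v x = j.
  by have [x _ fx] := fsurj j (ltn_ord j); exists x; apply: val_inj; rewrite /= fv.
(* The tree edges, [m] of them, numbered through [v]; the edges to count form the complement. *)
pose A : {pred 'I_m.+1 * 'I_m.+1} := [predX pred1 (v e) & predC1 (v (e ** e))].
have -> : (m.+1 ^ 2 - m.+1 + 1)%N = #|[predC A]|.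
  apply: (@addnI #|A|); rewrite cardC card_prod cardX card1 cardC1 !card_ord.
  by rewrite mul1n -mulnn mulSn addKn addn1 addnS.
pose g (p : Q * Q) := (v p.1, v p.2).
apply: card_eq_trans (card_eq_fin [predC A]).
have <- : g @` nontree e = [set p | p \in [predC A]].
  apply/seteqP; split=> [_ [[x y] /= xyD <-]|[j k]].
    rewrite !inE /= negb_and negbK; apply/orP.
    by case: xyD => /= [xe|->]; [left; apply/eqP => /vinj|right].
  have [[x <-] [y <-]] := (vsurj j, vsurj k).
  rewrite /= !inE /= negb_and negbK => /orP xyD; exists (x, y) => //.
  by case: xyD => [/eqP xe|/eqP/vinj ->]; [left => /= xE; rewrite xE in xe|right].
by apply/card_esym/inj_card_eq => -[x y] [x' y'] _ _ [/vinj -> /vinj ->].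
Qed.

Theorem theorem3p7 (Q QX : semisymmetricType) (i : Q -> QX)
    (hQX : is_adjoin_free i) (e : Q) :
  free_over (univ_stabilizer i e) (stabilizer_basis i e) /\
  (forall n : nat, ([set: Q] #= `I_n)%card ->
     free_of_rank (univ_stabilizer i e) (n ^ 2 - n + 1)%N).
Proof.
have free := univ_stabilizer_free hQX e; split=> // n Qn.
exists (stabilizer_basis i e); split=> //; rewrite stabilizer_basisE.
by apply: card_eq_trans (card_nontree e Qn); apply/inj_card_eq/schreier_inj.
Qed.
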